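(* Let $\Psi$ be a context of parameters with positive types, and let $M,N$ be simple linear patterns (without shared existential variables) with $\Psi\vdash M\Uparrow A$ and $\Psi\vdash N\Uparrow A$. If $\Psi\vdash M\cap N\Rightarrow Q:A$, then $Q$ is a simple linear pattern and $\Psi\vdash Q\Uparrow A$.
   Context: Strict $\lambda$-calculus over a signature $\Sigma$: labels $k\in\{1,0,u\}$; types $A::=a\mid A_1\to^kA_2$; terms $c\mid x\mid\lambda x^k{:}A.M\mid M_1M_2^k$. Positive types $P::=a\mid N\to^1P$, negative $N::=a\mid P\to^uN$; $\Sigma$ and $\Psi$ declare positive types; existential variables are a separate class. For $\Psi=x_1{:}A_1,\dots,x_n{:}A_n$ (fixed order) a label sequence is $\Phi=x_1^{k_1}\dots x_n^{k_n}$, $\Phi(x_i)=k_i$. Generalized variable over $\Psi$: $E\,\Phi$ of atomic type $a$, $E{:}A_1\to^{k_1}\cdots A_n\to^{k_n}a$. Simple patterns $\Psi\vdash M\Uparrow A$: $\lambda x^u{:}P.M\Uparrow P\to^uB$ if $(\Psi,x{:}P)\vdash M\Uparrow B$; $h\,M_1^1\dots M_n^1\Uparrow a$ if $h\in\mathrm{dom}(\Sigma\cup\Psi)$ has type $A_1\to^1\cdots\to^1A_n\to^1a$ and $M_i\Uparrow A_i$; $E\,\Phi\Uparrow a$ for generalized variables over $\Psi$. Linear: no existential variable occurs twice. Convention: fresh $H\,\Phi$ at non-atomic type $B_1\to^u\cdots\to^uB_m\to^ua$ means $\lambda y_1^u{:}B_1\dots\lambda y_m^u{:}B_m.H\,\Phi\,y_1^u\dots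 y_m^u$. Intersection: label intersection $1\cap1=u\cap1=1\cap u=1$, $0\cap0=u\cap0=0\cap u=0$, $u\cap u=u$ (others undefined), pointwise on sequences. $\Psi\vdash M\cap N\Rightarrow Q:A$ ($H$'s fresh): (FF) $(E_1\Phi_1)\cap(E_2\Phi_2)\Rightarrow H(\Phi_1\cap\Phi_2):a$ when defined; (FR$^c$) if $c{:}A_1\to^1\cdots\to^1A_n\to^1a\in\Sigma$ and $\Psi\vdash(H_i\Phi_i)\cap M_i\Rightarrow N_i:A_i$ for all $i$ then $\Psi\vdash(E\Phi)\cap(c\,M_1^1\dots M_n^1)\Rightarrow c\,N_1^1\dots N_n^1:a$, provided $\Phi(x)=0\Rightarrow$ all $\Phi_i(x)=0$, $\Phi(x)=u\Rightarrow$ all $\Phi_i(x)=u$, $\Phi(x)=1\Rightarrow$ exactly one $\Phi_i(x)=1$ and the others $u$; (FR$^y$) same with head $y\in\mathrm{dom}(\Psi)$, the $1$-clause only for $x\ne y$, and $\Phi(y)=1\Rightarrow$ all $\Phi_i(y)=u$; (RF$^c$),(RF$^y$) symmetric; (RR) if $h\in\mathrm{dom}(\Psi\cup\Sigma)$ and $\Psi\vdash M_i\cap N_i\Rightarrow Q_i:A_i$ then $(h\,M_1^1\dots M_n^1)\cap(h\,N_1^1\dots N_n^1)\Rightarrow h\,Q_1^1\dots Q_n^1:a$; (L) if $(\Psi,x{:}A)\vdash M\cap N\Rightarrow Q:B$ then $(\lambda x^u{:}A.M)\cap(\lambda x^u{:}A.N)\Rightarrow\lambda x^u{:}A.Q:A\to^uB$.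 *)

(* Defs.v *)
From mathcomp Require Import all_boot.

Set Implicit Arguments.
Unset Strict Implicit.
Unset Printing Implicit Defensive.

Inductive label := L1 | L0 | Lu.

Inductive ty (base : Type) :=
| Atom of base
| Arr of ty base & label & ty base.  (* [Arr A k B] is A ->^k B *)

Arguments Atom {base} _.
Arguments Arr {base} _ _ _.

Fixpoint positive (base : Type) (A : ty base) : bool :=
  match A with
  | Atom _ => true
  | Arr N L1 P => negative N && positive P
  | Arr _ _ _ => false
  end
with negative (base : Type) (A : ty base) : bool :=
  match A with
  | Atom _ => true
  | Arr P Lu N => positive P && negative N
  | Arr _ _ _ => false
  end.

(* Terms up to alpha-equivalence: parameters and bound variables are de Bruijn
   indices.  A context Psi = x_1:A_1, ..., x_n:A_n is the list
   [:: A_n; ...; A_1], so that index 0 is the last declared variable x_n; label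
   sequences over Psi are stored in the same reversed order. *)
Inductive term (base con evar : Type) :=
| Con of con
| Var of nat
| EVar of evar
| Lam of label & ty base & term base con evar
| App of term base con evar & term base con evar & label.  (* M1 M2^k *)

Arguments Con {base con evar} _.
Arguments Var {base con evar} _.
Arguments EVar {base con evar} _.
Arguments Lam {base con evar} _ _ _.
Arguments App {base con evar} _ _ _.

Definition label_cap (k l : label) : option label :=
  match k, l with
  | L1, L1 | Lu, L1 | L1, Lu => Some L1
  | L0, L0 | Lu, L0 | L0, Lu => Some L0
  | Lu, Lu => Some Lu
  | L1, L0 | L0, L1 => None
  end.

Fixpoint labels_cap (Phi1 Phi2 : seq label) : option (seq label) :=
  match Phi1, Phi2 with
  | [::], [::] => Some [::]
  | k :: Phi1', l :: Phi2' =>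
      if label_cap k l is Some m then
        if labels_cap Phi1' Phi2' is Some Phi then Some (m :: Phi) else None
      else None
  | _, _ => None
  end.

Section Patterns.

Variables (base con : Type) (evar : eqType).
(* Every existential variable carries its type. *)
Variable evty : evar -> ty base.
Variable Sigma : con -> option (ty base).

Local Notation ty := (ty base).
Local Notation term := (term base con evar).
Local Notation ctx := (seq ty).

Implicit Types (A B : ty) (a : base) (M N Q G : term) (Psi : ctx).
Implicit Types (E H : evar) (Phi : seq label) (F : seq evar).

(* A_1 ->^1 ... ->^1 A_n ->^1 a *)
Definition arrows (As : seq ty) a : ty :=
  foldr (fun A B => Arr A L1 B) (Atom a) As.

(* h M_1^1 ... M_n^1 *)
Definition spine (h : term) (Ms : seq term) : term :=
  foldl (fun M N => App M N L1) h Ms.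

(* A_1 ->^{k_1} ... A_n ->^{k_n} B, the innermost arrow coming from the last
   declared variable, i.e. the head of the reversed lists. *)
Fixpoint gen_ty Psi Phi B : ty :=
  match Psi, Phi with
  | A :: Psi', k :: Phi' => gen_ty Psi' Phi' (Arr A k B)
  | _, _ => B
  end.

Definition is_gen_var Psi E Phi a : Prop :=
  size Phi = size Psi /\ evty E = gen_ty Psi Phi (Atom a).

(* [gen_app i E Phi] applies E to the variables i + |Phi| - 1, ..., i, in
   declaration order; [gen_var E Phi] is E x_1^{k_1} ... x_n^{k_n}. *)
Fixpoint gen_app (i : nat) E Phi : term :=
  if Phi is k :: Phi' then App (gen_app i.+1 E Phi') (Var i) k else EVar E.

Definition gen_var E Phi : term := gen_app 0 E Phi.

Inductive head_ty Psi : term -> ty -> Prop :=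
| head_con c A : Sigma c = Some A -> head_ty Psi (Con c) A
| head_var y A : onth Psi y = Some A -> head_ty Psi (Var y) A.

(* Psi |- M ⇑ A *)
Inductive simple_pattern : ctx -> term -> ty -> Prop :=
| sp_lam Psi P M B :
    positive P -> simple_pattern (P :: Psi) M B ->
    simple_pattern Psi (Lam Lu P M) (Arr P Lu B)
| sp_rigid Psi h n (As : n.-tuple ty) (Ms : n.-tuple term) a :
    head_ty Psi h (arrows As a) ->
    (forall i : 'I_n, simple_pattern Psi (tnth Ms i) (tnth As i)) ->
    simple_pattern Psi (spine h Ms) (Atom a)
| sp_flex Psi E Phi a :
    is_gen_var Psi E Phi a -> simple_pattern Psi (gen_var E Phi) (Atom a).

(* All occurrences, with multiplicity. *)
Fixpoint evars M : seq evar :=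
  match M with
  | Con _ | Var _ => [::]
  | EVar E => [:: E]
  | Lam _ _ M' => evars M'
  | App M1 M2 _ => evars M1 ++ evars M2
  end.

Definition linear M : bool := uniq (evars M).

(* [fresh_at Psi H Phi A G]: G is what H Phi stands for at type
   A = B_1 ->^u ... ->^u B_m ->^u a.  Under the abstractions,
   H Phi y_1^u ... y_m^u is the generalized variable over Psi, y_1, ..., y_m
   whose label sequence is Phi followed by m labels u. *)
Inductive fresh_at : ctx -> evar -> seq label -> ty -> term -> Prop :=
| fresh_atom Psi H Phi a :
    is_gen_var Psi H Phi a -> fresh_at Psi H Phi (Atom a) (gen_var H Phi)
| fresh_arr Psi H Phi B A G :
    fresh_at (B :: Psi) H (Lu :: Phi) A G ->
    fresh_at Psi H Phi (Arr B Lu A) (Lam Lu B G).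

(* Exactly one Phi_i(x) is 1 and the others are u. *)
Definition one_strict n (Phis : n.-tuple (seq label)) (x : nat) : Prop :=
  exists i : 'I_n, onth (tnth Phis i) x = Some L1 /\
    forall j : 'I_n, j != i -> onth (tnth Phis j) x = Some Lu.

Definition all_labelled n (Phis : n.-tuple (seq label)) (x : nat) (k : label)
    : Prop :=
  forall i : 'I_n, onth (tnth Phis i) x = Some k.

Definition con_proviso Phi n (Phis : n.-tuple (seq label)) : Prop :=
  forall x : nat,
    [/\ onth Phi x = Some L0 -> all_labelled Phis x L0,
        onth Phi x = Some Lu -> all_labelled Phis x Lu
      & onth Phi x = Some L1 -> one_strict Phis x].

Definition var_proviso (y : nat) Phi n (Phis : n.-tuple (seq label)) : Prop :=
  forall x : nat,
    [/\ onth Phi x = Some L0 -> all_labelled Phis x L0,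
        onth Phi x = Some Lu -> all_labelled Phis x Lu,
        x <> y -> onth Phi x = Some L1 -> one_strict Phis x
      & x = y -> onth Phi x = Some L1 -> all_labelled Phis x Lu].

(* [inter Psi F M N Q A]: there is a derivation of Psi |- M ∩ N => Q : A whose
   introduced existential variables (the H's) are listed, with multiplicity, in
   F.  Freshness is a global condition on F, imposed in [intersection]. *)
Inductive inter : ctx -> seq evar -> term -> term -> term -> ty -> Prop :=
| inter_FF Psi E1 E2 H Phi1 Phi2 Phi a :
    labels_cap Phi1 Phi2 = Some Phi ->
    is_gen_var Psi H Phi a ->
    inter Psi [:: H] (gen_var E1 Phi1) (gen_var E2 Phi2) (gen_var H Phi)
      (Atom a)
| inter_FRc Psi E Phi c n (As : n.-tuple ty) a (Ms Gs Ns : n.-tuple term)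
    (Hs : n.-tuple evar) (Phis : n.-tuple (seq label))
    (Fs : n.-tuple (seq evar)) :
    Sigma c = Some (arrows As a) ->
    con_proviso Phi Phis ->
    (forall i : 'I_n,
       fresh_at Psi (tnth Hs i) (tnth Phis i) (tnth As i) (tnth Gs i)) ->
    (forall i : 'I_n,
       inter Psi (tnth Fs i) (tnth Gs i) (tnth Ms i) (tnth Ns i) (tnth As i)) ->
    inter Psi (Hs ++ flatten Fs)
      (gen_var E Phi) (spine (Con c) Ms) (spine (Con c) Ns) (Atom a)
| inter_FRy Psi E Phi y n (As : n.-tuple ty) a (Ms Gs Ns : n.-tuple term)
    (Hs : n.-tuple evar) (Phis : n.-tuple (seq label))
    (Fs : n.-tuple (seq evar)) :
    onth Psi y = Some (arrows As a) ->
    var_proviso y Phi Phis ->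
    (forall i : 'I_n,
       fresh_at Psi (tnth Hs i) (tnth Phis i) (tnth As i) (tnth Gs i)) ->
    (forall i : 'I_n,
       inter Psi (tnth Fs i) (tnth Gs i) (tnth Ms i) (tnth Ns i) (tnth As i)) ->
    inter Psi (Hs ++ flatten Fs)
      (gen_var E Phi) (spine (Var y) Ms) (spine (Var y) Ns) (Atom a)
| inter_RFc Psi E Phi c n (As : n.-tuple ty) a (Ms Gs Ns : n.-tuple term)
    (Hs : n.-tuple evar) (Phis : n.-tuple (seq label))
    (Fs : n.-tuple (seq evar)) :
    Sigma c = Some (arrows As a) ->
    con_proviso Phi Phis ->
    (forall i : 'I_n,
       fresh_at Psi (tnth Hs i) (tnth Phis i) (tnth As i) (tnth Gs i)) ->
    (forall i : 'I_n,
       inter Psi (tnth Fs i) (tnth Ms i) (tnth Gs i) (tnth Ns i) (tnth As i)) ->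
    inter Psi (Hs ++ flatten Fs)
      (spine (Con c) Ms) (gen_var E Phi) (spine (Con c) Ns) (Atom a)
| inter_RFy Psi E Phi y n (As : n.-tuple ty) a (Ms Gs Ns : n.-tuple term)
    (Hs : n.-tuple evar) (Phis : n.-tuple (seq label))
    (Fs : n.-tuple (seq evar)) :
    onth Psi y = Some (arrows As a) ->
    var_proviso y Phi Phis ->
    (forall i : 'I_n,
       fresh_at Psi (tnth Hs i) (tnth Phis i) (tnth As i) (tnth Gs i)) ->
    (forall i : 'I_n,
       inter Psi (tnth Fs i) (tnth Ms i) (tnth Gs i) (tnth Ns i) (tnth As i)) ->
    inter Psi (Hs ++ flatten Fs)
      (spine (Var y) Ms) (gen_var E Phi) (spine (Var y) Ns) (Atom a)
| inter_RR Psi h n (As : n.-tuple ty) a (Ms Ns Qs : n.-tuple term)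
    (Fs : n.-tuple (seq evar)) :
    head_ty Psi h (arrows As a) ->
    (forall i : 'I_n,
       inter Psi (tnth Fs i) (tnth Ms i) (tnth Ns i) (tnth Qs i) (tnth As i)) ->
    inter Psi (flatten Fs) (spine h Ms) (spine h Ns) (spine h Qs) (Atom a)
| inter_L Psi F A M N Q B :
    inter (A :: Psi) F M N Q B ->
    inter Psi F (Lam Lu A M) (Lam Lu A N) (Lam Lu A Q) (Arr A Lu B).

Definition disjoint_evars (F1 F2 : seq evar) : bool := ~~ has (mem F1) F2.

(* Psi |- M ∩ N => Q : A, with all H's of the derivation pairwise distinct and
   new with respect to M and N. *)
Definition intersection Psi M N Q A : Prop :=
  exists F : seq evar,
    [/\ inter Psi F M N Q A, uniq F & disjoint_evars F (evars M ++ evars N)].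

End Patterns.

(* Main.v *)
(** Membership in the pattern judgement is read off the derivation of the
    intersection: every rule builds the result with a typed head, a generalized
    variable over the context or an abstraction, and the domain of an
    abstraction is positive because the types met during the derivation are
    negative in positive contexts.  Linearity holds because each existential
    variable of the result is charged to a distinct fresh variable introduced
    by the derivation. *)

Require Import Defs.
From mathcomp Require Import all_boot.

Set Implicit Arguments.
Unset Strict Implicit.
Unset Printing Implicit Defensive.

Section Intersection.

Variables (base con : Type) (evar : eqType).
Variables (evty : evar -> ty base) (Sigma : con -> option (ty base)).

(** Only abstractions have non-atomic types, and their rule demands a positive domain. This supplies
    the negativity of [A] that starts the induction in [inter_simple_pattern]. *)
Lemma simple_pattern_negative Psi (M : term base con evar) A :
  simple_pattern evty Sigma Psi M A -> negative A.
Proof. by elim=> //= ? P ? B Ppos _ ->; rewrite Ppos. Qed.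

Lemma positive_arrows (As : seq (ty base)) a :
  positive (arrows As a) = all (@negative base) As.
Proof. by elim: As => //= A As ->. Qed.

Lemma evars_gen_app i (E : evar) Phi :
  evars (gen_app base con i E Phi) = [:: E].
Proof. by elim: Phi i => //= k Phi IH i; rewrite IH. Qed.

Lemma evars_spine (h : term base con evar) Ms :
  evars (spine h Ms) = evars h ++ flatten (map (@evars base con evar) Ms).
Proof.
by elim: Ms h => [|M Ms IH] h /=; rewrite ?cats0 // IH /= catA.
Qed.

Lemma evars_head Psi (h : term base con evar) A :
  head_ty Sigma Psi h A -> evars h = [::].
Proof. by case. Qed.

Lemma count_evars_spine (h : term base con evar) n
    (Qs : n.-tuple (term base con evar)) (Fs : n.-tuple (seq evar)) p :
  evars h = [::] ->
  (forall i, count p (evars (tnth Qs i)) <= count p (tnth Fs i)) ->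
  count p (evars (spine h Qs)) <= count p (flatten Fs).
Proof.
move=> h0 le_QF; rewrite evars_spine h0 !count_flatten !sumnE !big_map !big_tuple.
exact: leq_sum.
Qed.

(** In the flex-rigid rules the arguments of the result are charged to [Fs] alone. The variables
    [Hs] head the intermediate terms [Gs] and only enlarge the right-hand side, whence an
    inequality. *)
Lemma count_evars_inter Psi F (M N Q : term base con evar) A p :
  inter evty Sigma Psi F M N Q A -> count p (evars Q) <= count p F.
Proof.
elim=> //=.
- by move=> *; rewrite evars_gen_app.
- by move=> *; rewrite count_cat (leq_trans _ (leq_addl _ _)) ?count_evars_spine.
- by move=> *; rewrite count_cat (leq_trans _ (leq_addl _ _)) ?count_evars_spine.
- by move=> *; rewrite count_cat (leq_trans _ (leq_addl _ _)) ?count_evars_spine.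
- by move=> *; rewrite count_cat (leq_trans _ (leq_addl _ _)) ?count_evars_spine.
- by move=> ? h ? ? ? ? ? ? ? /evars_head h0 _ le_QF; exact: count_evars_spine.
Qed.

Hypothesis Sigma_pos : forall c B, Sigma c = Some B -> positive B.

Lemma head_ty_positive Psi (h : term base con evar) A :
  all (@positive base) Psi -> head_ty Sigma Psi h A -> positive A.
Proof.
move=> Psi_pos [c B|y B]; first exact: Sigma_pos.
elim: Psi Psi_pos y => [_ [] //|C Psi IH /= /andP[Cpos Psi_pos] [[<-] //|y]].
exact: IH.
Qed.

(** Serves all five rules with a rigid result. The last premise has the shape of their induction
    hypotheses; its negativity condition holds because a positive head type has negative argument
    types. *)
Lemma spine_simple_pattern Psi (h : term base con evar) n
    (As : n.-tuple (ty base)) a (Qs : n.-tuple (term base con evar)) :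
  all (@positive base) Psi -> head_ty Sigma Psi h (arrows As a) ->
  (forall i, all (@positive base) Psi -> negative (tnth As i) ->
     simple_pattern evty Sigma Psi (tnth Qs i) (tnth As i)) ->
  simple_pattern evty Sigma Psi (spine h Qs) (Atom a).
Proof.
move=> Psi_pos hA Qs_pat; apply: (sp_rigid hA) => i; apply: Qs_pat => //.
have := head_ty_positive Psi_pos hA.
by rewrite positive_arrows => /all_tnthP.
Qed.

(** Negativity of [A] is an invariant that passes to every premise, including those whose inputs are
    the intermediate terms [Gs]. *)
Lemma inter_simple_pattern Psi F (M N Q : term base con evar) A :
  inter evty Sigma Psi F M N Q A -> all (@positive base) Psi -> negative A ->
  simple_pattern evty Sigma Psi Q A.
Proof.
elim=> {Psi F M N Q A}.
- by move=> *; exact: sp_flex.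
- move=> Psi E Phi c n As a Ms Gs Ns Hs Phis Fs cA _ _ _ IH Psi_pos _.
  exact: spine_simple_pattern Psi_pos (head_con _ _ cA) IH.
- move=> Psi E Phi y n As a Ms Gs Ns Hs Phis Fs yA _ _ _ IH Psi_pos _.
  exact: spine_simple_pattern Psi_pos (head_var _ _ yA) IH.
- move=> Psi E Phi c n As a Ms Gs Ns Hs Phis Fs cA _ _ _ IH Psi_pos _.
  exact: spine_simple_pattern Psi_pos (head_con _ _ cA) IH.
- move=> Psi E Phi y n As a Ms Gs Ns Hs Phis Fs yA _ _ _ IH Psi_pos _.
  exact: spine_simple_pattern Psi_pos (head_var _ _ yA) IH.
- move=> Psi h n As a Ms Ns Qs Fs hA _ IH Psi_pos _.
  exact: spine_simple_pattern Psi_pos hA IH.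
- move=> Psi F A M N Q B _ IH Psi_pos /= /andP[Apos Bneg].
  by apply: sp_lam => //; apply: IH; rewrite //= Apos.
Qed.

End Intersection.

Theorem theorem7p9 (base con : Type) (evar : eqType) (evty : evar -> ty base)
    (Sigma : con -> option (ty base))
    (Sigma_pos : forall (c : con) (B : ty base), Sigma c = Some B -> positive B)
    (Psi : seq (ty base)) (Psi_pos : all (@positive base) Psi)
    (A : ty base) (M N Q : term base con evar)
    (M_pat : simple_pattern evty Sigma Psi M A) (M_lin : linear M)
    (N_pat : simple_pattern evty Sigma Psi N A) (N_lin : linear N)
    (MN_disj : disjoint_evars (evars M) (evars N)) :
  intersection evty Sigma Psi M N Q A ->
  linear Q /\ simple_pattern evty Sigma Psi Q A.
Proof.
move=> [F [MNQ uF _]]; split.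
  apply: count_mem_uniq => E.
  have := count_evars_inter (pred1 E) MNQ.
  (* Membership of [E] becomes positivity of its count. Since [F] is duplicate-free, that count is
     at most 1, hence equal to the truth value of its positivity. *)
  rewrite -has_pred1 has_count (count_uniq_mem _ uF).
  by case: (E \in F); case: (count _ _) => [|[]].
have A_neg := simple_pattern_negative M_pat.
exact: (inter_simple_pattern Sigma_pos MNQ Psi_pos A_neg).
Qed.
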